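(* Let $b=\{b_k\}_{k\ge0}$, $a=\{a_k\}_{k\ge0}$ and $\Lambda=\{\Lambda_k\}$ be sequences such that $$\mu_{2n}(\{0\},\{\Lambda_k\})=\mu_n(\{b_k\},\{a_k\},\{0\})\qquad\text{for all } n\ge0 .$$ For $n\ge0$ let $f_n(a,b)=\sum_p\mathrm{wt}(p)$, where the sum is over all $(n+1)$-tuples $p=(P_0,P_1,\dots,P_n)$ of non-intersecting Schröder paths with $P_k$ going from $(-k,0)$ to $(k,0)$ for $0\le k\le n$, and $\mathrm{wt}(p)=\prod_k\mathrm{wt}(P_k)$. Then, for all $n\ge1$ (all denominators being assumed nonzero), $$\Lambda_1\Lambda_2\cdots\Lambda_{2n}=\frac{f_n(a,b)}{f_{n-1}(a,b)}$$ and $$\Lambda_1\Lambda_2\cdots\Lambda_{2n-1}=a_0^{-1}\,\frac{f_n(\delta^{-1}a,\delta^{-1}b)}{f_{n-1}(\delta^{-1}a,\delta^{-1}b)}.$$ Moreover, if $a_k=b_k=1$ for all $k$, then $f_n(\{1\},\{1\})=2^{\binom{n+1}{2}}$ for all $n\ge 0$.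
   Context: Sequences take values in a field (for example, $a_k,b_k$ may be indeterminates). Moments: $\mu_n(\{0\},\{\Lambda_k\})$ is the $n$th moment of the orthogonal polynomials $p_{n+1}(x)=xp_n(x)-\Lambda_np_{n-1}(x)$, $p_{-1}=0$, $p_0=1$; it is given by the formal power series identity $$\sum_{n\ge0}\mu_n(\{0\},\{\Lambda_k\})t^n=\cfrac{1}{1-\cfrac{\Lambda_1t^2}{1-\cfrac{\Lambda_2t^2}{1-\cdots}}}.$$ $\mu_n(\{b_k\},\{a_k\},\{0\})$ is the $n$th moment of the type $R_I$ polynomials $r_{n+1}(x)=(x-b_n)r_n(x)-a_nx\,r_{n-1}(x)$, $r_{-1}=0$, $r_0=1$; it is given by $$\sum_{n\ge0}\mu_n(\{b_k\},\{a_k\},\{0\})t^n=\cfrac{1}{1-b_0t-\cfrac{a_1t}{1-b_1t-\cfrac{a_2t}{1-b_2t-\cdots}}}.$$ A Schröder path is a lattice path from $(r,0)$ to $(s,0)$, for integers $r,s$, consisting of northeast steps $(1,1)$, east steps $(1,0)$ and south steps $(0,-1)$, that never goes below the $x$-axis. Its weight $\mathrm{wt}(P)$ is the product of $b_i$ for each east step starting at height $i$ and $a_i$ for each south step starting at height $i$ (northeast steps have weight $1$). Paths are non-intersecting if no two of them share a lattice point; $P_0$ is the empty path at $(0,0)$. For a sequence $s=\{s_k\}_{k\ge0}$, $\delta^{-1}s=\{s_{k-1}\}_{k\ge0}$ with $s_{-1}:=1$, i.e. the sequence $1,s_0,s_1,\dots$ (the value of $s_{-1}$ is irrelevant). *)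

(* Defs.v *)
From HB Require Import structures.
From mathcomp Require Import all_boot all_order all_algebra.
From mathcomp Require Import zify.

Set Implicit Arguments.
Unset Strict Implicit.
Unset Printing Implicit Defensive.

Import Order.TTheory GRing.Theory Num.Theory.
Local Open Scope ring_scope.

(* f : fps F is the series \sum_n f n t^n; equality is pointwise. *)
Definition fps (F : fieldType) := nat -> F.

Section FormalPowerSeries.
Variable F : fieldType.
Implicit Types f g : fps F.

Definition fps_mono (c : F) d : fps F := fun n => if n == d then c else 0.
Definition fps_add f g : fps F := fun n => f n + g n.
Definition fps_sub f g : fps F := fun n => f n - g n.
Definition fps_mul f g : fps F := fun n => \sum_(i < n.+1) f i * g (n - i)%N.
Definition fps_exp f m : fps F := iter m (fps_mul f) (fps_mono 1 0).

(* 1 / (1 - g) = \sum_m g^m for g without constant term: the coefficient of t^n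
   only receives contributions from m <= n. *)
Definition fps_geom g : fps F := fun n => \sum_(m < n.+1) fps_exp g m n.

Lemma eq_fps_mul n f f' g g' :
  (forall i, (i <= n)%N -> f i = f' i) -> (forall i, (i <= n)%N -> g i = g' i) ->
  fps_mul f g n = fps_mul f' g' n.
Proof.
move=> ff' gg'; apply: eq_bigr => i _.
by rewrite ff' ?gg' ?leq_subr // -ltnS.
Qed.

Lemma eq_fps_exp n g g' m :
  (forall i, (i <= n)%N -> g i = g' i) -> fps_exp g m n = fps_exp g' m n.
Proof.
elim: m n => [//|m IHm] n gg'; apply: eq_fps_mul => // i lein.
by apply: IHm => j leji; apply: gg'; apply: leq_trans lein.
Qed.

Lemma eq_fps_geom n g g' :
  (forall i, (i <= n)%N -> g i = g' i) -> fps_geom g n = fps_geom g' n.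
Proof. by move=> gg'; apply: eq_bigr => m _; apply: eq_fps_exp. Qed.

Lemma fps_exp_small g m n : g 0%N = 0 -> (n < m)%N -> fps_exp g m n = 0.
Proof.
move=> g0; elim: m n => [//|m IHm] n ltnm; rewrite /fps_exp /= /fps_mul big1 // => i _.
case: i => -[|i] lti /=; first by rewrite g0 mul0r.
by rewrite [X in _ * X]IHm ?mulr0 //; lia.
Qed.

Lemma fps_geomP g n :
  g 0%N = 0 -> fps_mul (fps_sub (fps_mono 1 0) g) (fps_geom g) n = fps_mono 1 0 n.
Proof.
move=> g0.
have geomE k N : (k <= N)%N -> fps_geom g k = \sum_(m < N.+1) fps_exp g m k.
  move=> lekN; rewrite /fps_geom (big_ord_widen N.+1 (fun m => fps_exp g m k)) //.
  rewrite big_mkcond; apply: eq_bigr => m _; case: ifP => // /negbT.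
  by rewrite -leqNgt => ltkm; rewrite fps_exp_small.
have -> : fps_mul (fps_sub (fps_mono 1 0) g) (fps_geom g) n =
          fps_geom g n - fps_mul g (fps_geom g) n.
  rewrite /fps_mul /fps_sub.
  under eq_bigr do rewrite mulrBl.
  rewrite sumrB; congr (_ - _); rewrite big_ord_recl /= mul1r subn0 big1 ?addr0 //.
  by move=> i _; rewrite mul0r.
have -> : fps_mul g (fps_geom g) n = \sum_(m < n.+1) fps_exp g m.+1 n.
  rewrite [RHS]exchange_big /=; apply: eq_bigr => i _.
  by rewrite (geomE _ n) ?leq_subr // mulr_sumr.
rewrite (geomE _ n.+1) // big_ord_recl /=.
by rewrite addrK.
Qed.

(* Finite continued fraction starting at level k, with N + 1 levels:
   1 / (1 - B_k - A_(k+1) / (1 - B_(k+1) - ... - A_(k+N) / (1 - B_(k+N)))). *)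
Fixpoint cfrac (B A : nat -> fps F) (N k : nat) : fps F :=
  if N is N'.+1 then
    fps_geom (fps_add (B k) (fps_mul (A k.+1) (cfrac B A N' k.+1)))
  else fps_geom (B k).

(* The infinite continued fraction: the coefficient of t^n no longer depends on
   the truncation level N as soon as N >= n, see cfrac_stable. *)
Definition inf_cfrac (B A : nat -> fps F) : fps F := fun n => cfrac B A n 0 n.

Lemma cfrac_stable (B A : nat -> fps F) :
  (forall k, A k 0%N = 0) ->
  forall n N, (n <= N)%N -> cfrac B A N 0 n = inf_cfrac B A n.
Proof.
move=> A0 n N leN; rewrite /inf_cfrac.
have st m : forall M M' k, (m <= M)%N -> (m <= M')%N ->
    cfrac B A M k m = cfrac B A M' k m.
  have [p] := ubnP m; elim: p m => // p IHp m ltmp M M' k leM leM'.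
  have A0mul j f : fps_mul (A j) f 0%N = 0.
    by rewrite /fps_mul big_ord1 A0 mul0r.
  have tail M0 M1 i : (i < m)%N -> (m <= M0.+1)%N -> (m <= M1.+1)%N ->
      cfrac B A M0 k.+1 i = cfrac B A M1 k.+1 i.
    by move=> ltim le0 le1; apply: IHp; lia.
  case: M leM => [|M] leM; case: M' leM' => [|M'] leM' //=.
  - apply: eq_fps_geom => i leim; have -> : i = 0%N by lia.
    by rewrite /fps_add A0mul addr0.
  - apply: eq_fps_geom => i leim; have -> : i = 0%N by lia.
    by rewrite /fps_add A0mul addr0.
  apply: eq_fps_geom => i leim; rewrite /fps_add; congr (_ + _).
  rewrite /fps_mul !big_ord_recl /= !A0 !mul0r; congr (_ + _).
  apply: eq_bigr => j _; congr (_ * _); apply: tail => //.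
  by rewrite /bump /=; have := ltn_ord j; lia.
exact: st.
Qed.

(* \mu_n({0}, {Lambda_k}); Lambda 0 plays no role. *)
Definition mu_OP (Lambda : nat -> F) : fps F :=
  inf_cfrac (fun=> fps_mono 0 0) (fun k => fps_mono (Lambda k) 2).

(* \mu_n({b_k}, {a_k}, {0}); a 0 plays no role. *)
Definition mu_RI (b a : nat -> F) : fps F :=
  inf_cfrac (fun k => fps_mono (b k) 1) (fun k => fps_mono (a k) 1).

End FormalPowerSeries.

Inductive step := NE | East | South.

Definition step_to_ord (s : step) : 'I_3 :=
  match s with NE => inord 0 | East => inord 1 | South => inord 2 end.
Definition ord_to_step (i : 'I_3) : step :=
  match val i with 0%N => NE | 1%N => East | _ => South end.
Lemma step_to_ordK : cancel step_to_ord ord_to_step.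
Proof. by case; rewrite /ord_to_step /= inordK. Qed.

HB.instance Definition _ := Finite.copy step (can_type step_to_ordK).

Definition move (v : int * int) (s : step) : int * int :=
  match s with
  | NE => (v.1 + 1, v.2 + 1)
  | East => (v.1 + 1, v.2)
  | South => (v.1, v.2 - 1)
  end.

Definition vertices (v : int * int) (p : seq step) : seq (int * int) :=
  v :: scanl move v p.

Definition schroder (r s : int) (p : seq step) : bool :=
  (foldl move (r, 0) p == (s, 0)) && all (fun v => 0 <= v.2) (vertices (r, 0) p).

(* Heights are nonnegative along a Schroeder path, so the absolute value only
   converts them to nat. *)
Fixpoint wt_from (F : fieldType) (a b : nat -> F) (v : int * int) (p : seq step) : F :=
  if p is s :: p' then
    match s with NE => 1 | East => b `|v.2|%N | South => a `|v.2|%N end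
    * wt_from a b (move v s) p'
  else 1.

Lemma schroder_size (k : nat) (p : seq step) :
  schroder (- k%:Z) k%:Z p -> (size p <= 4 * k)%N.
Proof.
case/andP=> /eqP endp _.
have sz q v : (size q)%:Z <=
    2 * ((foldl move v q).1 - v.1) - ((foldl move v q).2 - v.2).
  elim: q v => [|s q IHq] v /=; first by lia.
  by have := IHq (move v s); case: s => /=; lia.
by have := sz p (- k%:Z, 0); rewrite endp /=; lia.
Qed.

(* A candidate (P_0, ..., P_n). The length bound, there to have a finite type,
   excludes no path from (-k, 0) to (k, 0) with k <= n, see schroder_size. *)
Definition path_tuple (n : nat) := {ffun 'I_n.+1 -> (4 * n).-bseq step}.

Definition path_vertices n (P : path_tuple n) (k : 'I_n.+1) : seq (int * int) :=
  vertices (- k%:Z, 0) (P k).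

Definition nonintersecting n (P : path_tuple n) : bool :=
  [forall i, forall j, (i != j) ==>
    ~~ has (fun v => v \in path_vertices P j) (path_vertices P i)].

Definition admissible n (P : path_tuple n) : bool :=
  [forall k : 'I_n.+1, schroder (- k%:Z) k%:Z (P k)] && nonintersecting P.

Definition f_ (F : fieldType) (n : nat) (a b : nat -> F) : F :=
  \sum_(P : path_tuple n | admissible P)
    \prod_(k < n.+1) wt_from a b (- k%:Z, 0) (P k).

Definition delta_inv (F : fieldType) (s : nat -> F) : nat -> F :=
  fun k => if k is k'.+1 then s k' else 1.

(* Main.v *)
Require Import Defs.
From mathcomp Require Import all_boot all_order all_algebra.
From mathcomp Require Import zify ring.
From Stdlib Require Import FunctionalExtensionality.

(** Write m_n for the moments mu_RI b a n.  Both product formulas and the count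
of the unweighted tuples come from one chain:

  non-intersecting paths  =  Hankel determinant of m  =  product of lambdas.

Paths to determinant ([f_hankel_moments]).  The total weight of the Schroeder
paths from (-i, 0) to (j, 0) is m_(i+j), because the continued fraction of the
type R_I moments, unfolded level by level, is the first-passage decomposition of
such paths ([tailE]); this gives the recursion of these weights on the first
step ([schroder_tableSS] and its companions).  The Lindstroem-Gessel-Viennot
lemma then gives f_n = det (m_(i+j)).  No sign-reversing involution is used: the
paths are grown simultaneously, always prolonging the one whose current end (its
head) no other path can still reach, namely the leftmost and, in its column,
highest one.  The sum over tuples splits according to the next step; the
determinant splits in the same way because its entries, as functions of the
head, obey the same recursion ([path_sum_advance], [green_det_advance]).  When
two heads meet, the sum is empty and the determinant has two equal rows, so both
vanish; they also vanish when a head has no end point within reach.  Otherwise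
the planar order of the heads ([nested]) is preserved by each move, so the
process can only end with path i at (i, 0), where the determinant is that of the
identity matrix.

Determinant to product ([hankel_det]).  Suppose that m_n is the first column of
a Stieltjes table, i.e. the array L(n, k) counting Motzkin prefixes with level
weights beta_k and down weights lambda_k.  Then m_(i+j) is the sum over k of
lambda_1 ... lambda_k L(i, k) L(j, k), and since L is unitriangular the Hankel
determinant is the product of the lambda_1 ... lambda_k for k <= n.

The tables.  The table with beta = 0 and lambda = Lambda has the moments mu_OP
Lambda ([dyck_table]).  Keeping its even rows and columns yields a Stieltjes
table for m_n = mu_2n with lambda_k = Lambda_(2k-1) Lambda_2k
([even_contraction]); hence f_n / f_(n-1) is Lambda_1 ... Lambda_2n.  Keeping
the odd ones yields a table for the shifted moments ([odd_contraction]).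
Shifting a and b by delta_inv replaces the moment series G by 1 / (1 - t - a_0 t
G), which puts one new level below the odd table ([stieltjes_cons]), with
lambda_1 = a_0 Lambda_1 and lambda_k = Lambda_(2k-2) Lambda_(2k-1) for k > 1;
hence the second ratio.

For a = b = 1 the shift does nothing, so G itself is obtained by putting one
level below the table with beta = 3 and lambda = 2, and every lambda is 2
([f_ones]).  This argument is division-free, hence valid in characteristic 2. *)

Set Implicit Arguments.
Unset Strict Implicit.
Unset Printing Implicit Defensive.

Import Order.TTheory GRing.Theory Num.Theory.
Local Open Scope ring_scope.

(** * Power series and the tails of a continued fraction *)

Section Series.
Variable F : fieldType.
Implicit Types f g h : fps F.

Lemma coef_trunc N f i : (i < N)%N -> (\poly_(j < N) f j)`_i = f i.
Proof. by rewrite coef_poly => ->. Qed.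

(** The convolution of series agrees with the product of truncated polynomials,
which transfers commutativity and associativity from {poly F}. *)
Lemma fps_mul_coef N f g n : (n < N)%N ->
  fps_mul f g n = (\poly_(i < N) f i * \poly_(i < N) g i)`_n.
Proof.
move=> ltnN; rewrite coefM; apply: eq_bigr => i _.
by rewrite !coef_trunc //; have := ltn_ord i; lia.
Qed.

Lemma fps_mulC f g : fps_mul f g = fps_mul g f.
Proof.
by apply: functional_extensionality => n; rewrite !(fps_mul_coef _ _ (ltnSn n)) mulrC.
Qed.

Lemma fps_mulA f g h : fps_mul f (fps_mul g h) = fps_mul (fps_mul f g) h.
Proof.
apply: functional_extensionality => n.
rewrite !(fps_mul_coef _ _ (ltnSn n)).
transitivity ((\poly_(i < n.+1) f i * (\poly_(i < n.+1) g i * \poly_(i < n.+1) h i))`_n).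
  rewrite !coefM; apply: eq_bigr => i _; congr (_ * _).
  have lt_i : (n - i < n.+1)%N by rewrite ltnS leq_subr.
  by rewrite coef_trunc // (fps_mul_coef _ _ lt_i).
rewrite mulrA !coefM; apply: eq_bigr => i _; congr (_ * _).
by rewrite coef_trunc // (fps_mul_coef _ _ (ltn_ord i)).
Qed.

Lemma fps_mulDl f g h :
  fps_mul (fps_add f g) h = fps_add (fps_mul f h) (fps_mul g h).
Proof.
apply: functional_extensionality => n; rewrite /fps_mul /fps_add -big_split /=.
by apply: eq_bigr => i _; rewrite mulrDl.
Qed.

Lemma fps_mulDr f g h :
  fps_mul h (fps_add f g) = fps_add (fps_mul h f) (fps_mul h g).
Proof. by rewrite !(fps_mulC h) fps_mulDl. Qed.

Lemma fps_mul_mono c d f n :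
  fps_mul (fps_mono c d) f n = if (d <= n)%N then c * f (n - d)%N else 0.
Proof.
rewrite /fps_mul /fps_mono; case: leqP => [led|ltd].
  have ltd : (d < n.+1)%N by [].
  rewrite (bigD1 (Ordinal ltd)) //= eqxx big1 ?addr0 // => i ned.
  case: eqP => [eid|]; last by rewrite mul0r.
  by case/eqP: ned; apply: val_inj.
rewrite big1 // => i _; case: eqP => [eid|]; last by rewrite mul0r.
by have := ltn_ord i; lia.
Qed.

Lemma fps_mul1 f : fps_mul (fps_mono 1 0) f = f.
Proof.
by apply: functional_extensionality => n; rewrite fps_mul_mono subn0 mul1r.
Qed.

(** A quotient 1 / (1 - g) is used through its fixed-point equation
f = 1 + g f rather than through the sum of the powers of g. *)
Lemma eq_mul_geom f g : g 0%N = 0 ->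
  f = fps_geom g -> f = fps_add (fps_mono 1 0) (fps_mul g f).
Proof.
move=> g0 ->; apply: functional_extensionality => n.
have := fps_geomP n g0.
have -> : fps_sub (fps_mono 1 0) g = fps_add (fps_mono 1 0) (fun i => - g i) by [].
rewrite fps_mulDl fps_mul1 /fps_add => /(canRL (addrK _)) ->; congr (_ + _).
by rewrite /fps_mul -sumrN; apply: eq_bigr => i _; rewrite mulNr opprK.
Qed.

Section Tails.
Variables B A : nat -> fps F.

(** Diagonal truncation, as for [inf_cfrac]: level n already determines the
coefficient of t^n. *)
Definition tail k : fps F := fun n => cfrac B A n k n.

Lemma cfrac_shift N k : cfrac B A N k =
  cfrac (fun i => B (i + k)%N) (fun i => A (i + k)%N) N 0.
Proof.
rewrite -[in LHS](add0n k); elim: N 0%N => [//|N IHN] i /=.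
by rewrite -IHN.
Qed.

Lemma tail_shift B' A' k :
    B' =1 (fun i => B (i + k)%N) -> A' =1 (fun i => A (i + k)%N) ->
  inf_cfrac B' A' = tail k.
Proof.
move=> /functional_extensionality -> /functional_extensionality ->.
by apply: functional_extensionality => n; rewrite /tail cfrac_shift.
Qed.

Hypothesis B0 : forall k, B k 0%N = 0.
Hypothesis A0 : forall k, A k 0%N = 0.

Lemma tail_stable k n N : (n <= N)%N -> cfrac B A N k n = tail k n.
Proof.
by move=> le_nN; rewrite /tail !(cfrac_shift _ k) !cfrac_stable // => i; apply: A0.
Qed.

(** First-passage decomposition: a path above level k is empty, or starts with a
step of B k, or with an excursion above level k.+1 closed by a step of A k.+1. *)
Lemma tailE k : tail k = fps_add (fps_mono 1 0)
  (fps_mul (fps_add (B k) (fps_mul (A k.+1) (tail k.+1))) (tail k)).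
Proof.
apply: eq_mul_geom.
  by rewrite /fps_add /fps_mul big_ord1 A0 B0 mul0r addr0.
apply: functional_extensionality => n.
rewrite -(tail_stable k (leqnSn n)) /=.
apply: eq_fps_geom => i le_in; congr (_ + _); apply: eq_fps_mul => // j le_ji.
by rewrite tail_stable //; apply: leq_trans le_in.
Qed.

Lemma tail0 k : tail k 0%N = 1.
Proof.
rewrite tailE /fps_add {1}/fps_mul big_ord1 /fps_mul big_ord1.
by rewrite A0 B0 !mul0r addr0 mul0r addr0.
Qed.

(** C_0 C_1 ... C_k for the tails C_i.  Cutting a path that ends at height k at its
last visits to the heights 0, ..., k shows that this series counts such
paths, up to the weights of the k unmatched steps. *)
Fixpoint tail_prod k : fps F :=
  if k is k'.+1 then fps_mul (tail_prod k') (tail k) else tail 0.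

Lemma tail_prod_rec0 : tail_prod 0 = fps_add (fps_mono 1 0)
  (fps_add (fps_mul (B 0) (tail_prod 0)) (fps_mul (A 1) (tail_prod 1))).
Proof.
by rewrite /= {1}(tailE 0) fps_mulDl -fps_mulA (fps_mulC (tail 1)).
Qed.

(** The fixed-point equation of C_(k+1) multiplied by C_0 ... C_k. *)
Lemma tail_prod_rec k : tail_prod k.+1 = fps_add (tail_prod k)
  (fps_add (fps_mul (B k.+1) (tail_prod k.+1)) (fps_mul (A k.+2) (tail_prod k.+2))).
Proof.
rewrite /= {1}(tailE k.+1) fps_mulDr [fps_mul _ (fps_mono _ _)]fps_mulC fps_mul1.
congr fps_add; rewrite fps_mulDl fps_mulDr; congr fps_add.
  by rewrite !fps_mulA (fps_mulC (B _)).
rewrite -!fps_mulA (fps_mulC (tail k.+2)) !fps_mulA.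
by rewrite (fps_mulC (tail_prod k)).
Qed.

Lemma tail_prod0 k : tail_prod k 0%N = 1.
Proof.
by elim: k => [|k IHk] /=; rewrite ?tail0 // /fps_mul big_ord1 IHk tail0 mulr1.
Qed.

End Tails.

End Series.

(** * Weighted counts of Schroeder paths from a continued fraction *)

Section SchroderTable.
Variables (F : fieldType) (a b : nat -> F).

Let B k : fps F := fps_mono (b k) 1.
Let A k : fps F := fps_mono (a k) 1.

(** The weight of the Schroeder paths from height y down to height 0 over a
horizontal distance d; the product of the a i accounts for the y descents
that are not matched by an ascent. *)
Definition schroder_table y d : F :=
  (\prod_(1 <= i < y.+1) a i) * tail_prod B A y d.

Let B0 k : B k 0%N = 0. Proof. by []. Qed.
Let A0 k : A k 0%N = 0. Proof. by []. Qed.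

Lemma schroder_table_moment d : schroder_table 0 d = mu_RI b a d.
Proof. by rewrite /schroder_table big_geq // mul1r. Qed.

Lemma schroder_table00 : schroder_table 0 0 = 1.
Proof. by rewrite /schroder_table tail_prod0 // mulr1 big_geq. Qed.

Lemma schroder_tableS0 y : schroder_table y.+1 0 = a y.+1 * schroder_table y 0.
Proof. by rewrite /schroder_table !tail_prod0 // !mulr1 big_nat_recr //= mulrC. Qed.

Lemma schroder_table0S d :
  schroder_table 0 d.+1 = b 0%N * schroder_table 0 d + schroder_table 1 d.
Proof.
rewrite /schroder_table big_geq // !mul1r {1}tail_prod_rec0 // /fps_add.
rewrite !fps_mul_mono [(1 <= d.+1)%N]/= !subn1 [fps_mono 1 _ _]/fps_mono /= add0r.
by rewrite big_nat1.
Qed.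

Lemma schroder_tableSS y d : schroder_table y.+1 d.+1 =
  a y.+1 * schroder_table y d.+1 + b y.+1 * schroder_table y.+1 d
  + schroder_table y.+2 d.
Proof.
rewrite /schroder_table {1}tail_prod_rec // /fps_add.
rewrite !fps_mul_mono [(1 <= d.+1)%N]/= subSS subn0.
rewrite (@big_nat_recr _ _ _ y.+2) //= (@big_nat_recr _ _ _ y.+1) //=.
ring.
Qed.

End SchroderTable.

(** * Stieltjes tables, their Hankel determinants and contractions *)

Section Jacobi.
Variable F : fieldType.
Implicit Types (beta lambda : nat -> F) (L : nat -> nat -> F).

(** L n k is the weight of the Motzkin paths of length n from height 0 to height k,
with weight beta k for a level step at height k and lambda k for a descent
starting at height k. *)
Definition stieltjes_table beta lambda L : Prop :=
  [/\ forall k, L 0%N k = (k == 0%N)%:R,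
      forall n, L n.+1 0%N = beta 0%N * L n 0%N + lambda 1%N * L n 1%N
    & forall n k, L n.+1 k.+1 =
        L n k + beta k.+1 * L n k.+1 + lambda k.+2 * L n k.+2].

Lemma stieltjes_table_exists beta lambda :
  exists2 L, stieltjes_table beta lambda L &
    forall n, L n 0%N =
      inf_cfrac (fun k => fps_mono (beta k) 1) (fun k => fps_mono (lambda k) 2%N) n.
Proof.
pose B k : fps F := fps_mono (beta k) 1; pose A k : fps F := fps_mono (lambda k) 2%N.
have B0 k : B k 0%N = 0 by [].
have A0 k : A k 0%N = 0 by [].
(* A path ending at height k has k unmatched ascents, each of length one, which
   shift the exponent of t by k. *)
exists (fun n k => if (k <= n)%N then tail_prod B A k (n - k)%N else 0)
  => [|n]; last first.
  by rewrite leq0n subn0.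
split=> [k|n|n k].
- by rewrite leqn0; case: eqP => // ->; rewrite tail_prod0.
- rewrite !leq0n !subn0 {1}tail_prod_rec0 // /fps_add !fps_mul_mono /=.
  rewrite {1}/fps_mono /= add0r subn1 /=; congr (_ + _).
    by rewrite ?subn1.
  by case: n => [|n] /=; rewrite ?mulr0 ?subn2 ?subn1.
- rewrite ltnS; case: (leqP k n) => [le_kn|lt_nk]; last first.
    by rewrite !ifF ?mulr0 ?addr0 //; lia.
  rewrite subSS {1}tail_prod_rec // /fps_add !fps_mul_mono -addrA; congr (_ + (_ + _)).
    case: (ltnP k n) => [lt_kn|ge]; last by rewrite ifF ?mulr0 //; lia.
    by rewrite ifT; last lia; congr (_ * tail_prod _ _ _ _); lia.
  case: (ltnP k.+1 n) => [lt_kn|ge]; last by rewrite ifF ?mulr0 //; lia.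
  by rewrite ifT; last lia; congr (_ * tail_prod _ _ _ _); lia.
Qed.

Section Hankel.
Variables (beta lambda : nat -> F) (L : nat -> nat -> F).
Hypothesis tabL : stieltjes_table beta lambda L.

Lemma stieltjes_table_small n k : (n < k)%N -> L n k = 0.
Proof.
case: tabL => L0 L1 L2; elim: n k => [|n IHn] [|k] // lt_nk.
by rewrite L2 !IHn ?mulr0 ?addr0 //; lia.
Qed.

Lemma stieltjes_table_diag n : L n n = 1.
Proof.
case: tabL => L0 L1 L2; elim: n => [|n IHn]; first by rewrite L0.
by rewrite L2 IHn !stieltjes_table_small ?mulr0 ?addr0 //; lia.
Qed.

(** The squared norm of the k-th orthogonal polynomial. *)
Let w k : F := \prod_(1 <= i < k.+1) lambda i.

(** The tridiagonal recursion of L is symmetric for the bilinear form with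
weights w, because w k * lambda k.+1 = w k.+1: multiplication by x is
self-adjoint. *)
Lemma stieltjes_shift K i j : (i < K)%N -> (j < K)%N ->
  \sum_(k < K) w k * L i.+1 k * L j k = \sum_(k < K) w k * L i k * L j.+1 k.
Proof.
case: tabL => L0 L1 L2.
have wS k : w k.+1 = w k * lambda k.+1 by rewrite /w big_nat_recr.
have main i' j' : (i' < K)%N -> \sum_(k < K) w k * L i'.+1 k * L j' k =
   \sum_(k < K) w k * beta k * L i' k * L j' k +
   \sum_(k < K.-1) w k.+1 * (L i' k * L j' k.+1 + L i' k.+1 * L j' k).
  case: K => // K lt_iK; rewrite /=.
  rewrite [LHS]big_ord_recl [X in X + _ = _]/=.
  rewrite L1 /=.
  under eq_bigr do rewrite /= L2.
  rewrite [X in _ = X + _]big_ord_recl /=.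
  have -> : \sum_(k < K) w k.+1 * (L i' k * L j' k.+1 + L i' k.+1 * L j' k) =
    \sum_(k < K) w k.+1 * L i' k * L j' k.+1
     + \sum_(k < K.+1) w k.+1 * L i' k.+1 * L j' k.
    rewrite big_ord_recr /= (stieltjes_table_small lt_iK) !(mulr0, mul0r) addr0.
    by rewrite -big_split /=; apply: eq_bigr => k _; ring.
  rewrite big_ord_recl /= (wS 0%N).
  set X := w 0%N; set S := \sum_(k < K) _.
  have -> : S = \sum_(k < K) w k.+1 * L i' k * L j' k.+1 +
     \sum_(k < K) w k.+1 * beta k.+1 * L i' k.+1 * L j' k.+1 +
     \sum_(k < K) w k.+2 * L i' k.+2 * L j' k.+1.
    by rewrite -!big_split /=; apply: eq_bigr => k _; rewrite (wS k.+1); ring.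
  by ring.
move=> ltiK ltjK; rewrite main //.
under [RHS]eq_bigr do rewrite mulrAC.
rewrite main //; congr (_ + _); apply: eq_bigr => k _; ring.
Qed.

(** Cut a path of length i + j after i steps: the second half, reversed, is again
a prefix, and reversing trades the descents for the factor w k.  Formally all
shifts are moved to one side with [stieltjes_shift]. *)
Lemma stieltjes_gram K i j : (i + j < K)%N ->
  \sum_(k < K) w k * L i k * L j k = L (i + j)%N 0%N.
Proof.
elim: i j => [|i IHi] j ltK; last first.
  by rewrite stieltjes_shift; try lia; rewrite IHi ?addSnnS //; lia.
case: tabL => L0 _ _; case: K ltK => // K _.
rewrite big_ord_recl L0 /w big_geq //= big1 ?addr0 ?mul1r // => k _.
by rewrite L0 mulr0 mul0r.
Qed.

(** [stieltjes_gram] is a factorisation P * diag * P^T with P unitriangular. *)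
Lemma hankel_det n :
  \det (\matrix_(i < n, j < n) L (i + j)%N 0%N) =
  \prod_(k < n) \prod_(1 <= i < k.+1) lambda i.
Proof.
pose P : 'M[F]_n := \matrix_(i, k) L i k.
have -> : (\matrix_(i < n, j < n) L (i + j)%N 0%N) =
          P *m diag_mx (\row_k w k) *m P^T.
  apply/matrixP => i j; rewrite mxE [RHS]mxE.
  (* The shifts need a summation range beyond i + j; the terms k >= n vanish. *)
  have ltK : (i + j < n + n)%N by have := ltn_ord i; have := ltn_ord j; lia.
  rewrite -(stieltjes_gram ltK) big_split_ord /= [X in _ + X]big1 ?addr0; last first.
    move=> k _; rewrite (@stieltjes_table_small i) ?mulr0 ?mul0r //.
    by have := ltn_ord i; lia.
  by apply: eq_bigr => k _; rewrite mul_mx_diag !mxE (mulrC (w k)).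
rewrite !det_mulmx det_tr det_diag.
have -> : \det P = 1.
  rewrite det_trig; first by rewrite big1 // => i _; rewrite mxE stieltjes_table_diag.
  by apply/is_trig_mxP => i j ltij; rewrite mxE stieltjes_table_small.
by rewrite mul1r mulr1; apply: eq_bigr => k _; rewrite mxE.
Qed.

End Hankel.

Section Contraction.
Variables (Lambda : nat -> F) (L : nat -> nat -> F).
Hypothesis tabL : stieltjes_table (fun=> 0) Lambda L.

(** Two consecutive Dyck steps from an even height are one Motzkin step: up-up,
down-down, or a return.  The latter is up-down or down-up, but only up-down at
height 0, whence the case distinction in the level weight. *)
Lemma even_contraction :
  stieltjes_table
    (fun k => (if k is _.+1 then Lambda (2 * k)%N else 0) + Lambda (2 * k).+1)
    (fun k => Lambda (2 * k).-1 * Lambda (2 * k)%N)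
    (fun n k => L (2 * n)%N (2 * k)%N).
Proof.
case: tabL => L0 L1 L2.
have M1 m : ((2 * m.+1).-1 = (2 * m).+1)%N by lia.
have M2 m : (2 * m.+1 = (2 * m).+2)%N by lia.
split=> [k|n|n k]; cbn beta iota; rewrite ?M1 ?M2.
- by rewrite L0; congr (_ %:R); lia.
- by rewrite !muln0 L1 !L2; ring.
- by rewrite ?M1 ?M2 !L2; ring.
Qed.

(** As [even_contraction], read from odd heights, where no special case occurs at
the bottom since both ways of returning exist. *)
Lemma odd_contraction :
  stieltjes_table (fun k => Lambda (2 * k).+1 + Lambda (2 * k).+2)
    (fun k => Lambda (2 * k)%N * Lambda (2 * k).+1)
    (fun n k => L (2 * n).+1 (2 * k).+1).
Proof.
case: tabL => L0 L1 L2.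
have M2 m : (2 * m.+1 = (2 * m).+2)%N by lia.
split=> [k|n|n k]; cbn beta.
- rewrite muln0; case: k => [|k]; first by rewrite L2 !L0 /=; ring.
  by rewrite M2 L2 !L0 /=; ring.
- by rewrite ?M2 !muln0 (L2 (2 * n).+2) L1 !(L2 (2 * n).+1); ring.
- by rewrite !M2 !L2; ring.
Qed.

Lemma moment_odd n : L (2 * n.+1)%N 0%N = Lambda 1%N * L (2 * n).+1 1%N.
Proof.
case: tabL => L0 L1 L2; have -> : (2 * n.+1 = (2 * n).+2)%N by lia.
by rewrite L1 mul0r add0r.
Qed.

End Contraction.

(** With series, the assumptions say G = 1 + c t J and
G' = 1 / (1 - b0 t - a0 t G), where J is the moment series of (beta, lambda); so
G' = 1 / (1 - (b0 + a0) t - a0 c t^2 J), a continued fraction with one more level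
below. *)
Lemma stieltjes_cons beta lambda L1 (G G' : nat -> F) (b0 a0 c : F) :
    stieltjes_table beta lambda L1 ->
    G 0%N = 1 -> (forall n, G n.+1 = c * L1 n 0%N) ->
    G' 0%N = 1 ->
    (forall n, G' n.+1 = b0 * G' n + a0 * \sum_(i < n.+1) G' i * G (n - i)%N) ->
  exists2 L, stieltjes_table
      (fun k => if k is k'.+1 then beta k' else b0 + a0)
      (fun k => if k is k'.+2 then lambda k'.+1 else a0 * c) L
    & forall n, L n 0%N = G' n.
Proof.
move=> [L0 L1S L2] G0 GS G'0 G'S.
(* A path ending at height k.+1 stays at height 0 up to its last visit, at time
   i, then climbs and follows a path of the old table. *)
exists (fun n h =>
  if h is k.+1 then \sum_(i < n) G' i * L1 (n - i).-1 k else G' n) => //.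
split=> [[|k]|n|n [|k]].
- by rewrite G'0.
- by rewrite big_ord0.
- rewrite G'S big_ord_recr /= subnn G0.
  rewrite mulrDr mulr1 mulrDl addrA addrAC -!addrA; congr (_ + (_ + _)).
  rewrite -mulrA; congr (_ * _); rewrite mulr_sumr; apply: eq_bigr => i _.
  have := ltn_ord i; case E : (n - i)%N => [|m] lti; first by lia.
  by rewrite GS /=; ring.
- rewrite big_ord_recr /= subSnn L0 /= mulr1 addrC -!addrA; congr (_ + _).
  rewrite !mulr_sumr -big_split /=; apply: eq_bigr => i _.
  have lti := ltn_ord i; have -> : (n.+1 - i).-1 = (n - i).-1.+1 by lia.
  by rewrite L1S; ring.
- rewrite big_ord_recr /= subSnn L0 /= mulr0 addr0.
  rewrite !mulr_sumr -!big_split /=; apply: eq_bigr => i _.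
  have lti := ltn_ord i; have -> : (n.+1 - i).-1 = (n - i).-1.+1 by lia.
  by rewrite L2; ring.
Qed.

End Jacobi.

(** * Expanding a determinant along a row *)

Lemma det_row_lincomb (R : comNzRingType) (I : finType) m (i0 : 'I_m)
    (M : 'M[R]_m) (c : I -> R) (N : I -> 'M[R]_m) :
    (forall j, M i0 j = \sum_s c s * N s i0 j) ->
    (forall s i j, i != i0 -> N s i j = M i j) ->
  \det M = \sum_s c s * \det (N s).
Proof.
move=> rowM offM; rewrite (expand_det_row _ i0).
under eq_bigr do rewrite rowM mulr_suml.
rewrite exchange_big; apply: eq_bigr => s _ /=.
rewrite (expand_det_row _ i0) mulr_sumr; apply: eq_bigr => j _.
rewrite -mulrA; congr (_ * (_ * (_ * \det _))).
by apply/matrixP => i k; rewrite !mxE offM // eq_sym neq_lift.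
Qed.

Lemma det_row0 (R : comNzRingType) m (i0 : 'I_m) (M : 'M[R]_m) :
  (forall j, M i0 j = 0) -> \det M = 0.
Proof.
by move=> M0; rewrite (expand_det_row _ i0) big1 // => j _; rewrite M0 mul0r.
Qed.

(** * Schroeder paths step by step *)

Section Paths.
Implicit Types (v w : int * int) (p q : seq step).

Definition endpoint v p := foldl move v p.
(** Separated from the end point, which alone moves when a step is appended. *)
Definition history v p := belast v (scanl move v p).

Lemma endpoint_rcons v p s : endpoint v (rcons p s) = move (endpoint v p) s.
Proof. exact: foldl_rcons. Qed.

Lemma vertices_rcons v p s :
  vertices v (rcons p s) = rcons (vertices v p) (move (endpoint v p) s).
Proof. by rewrite /vertices scanl_rcons foldl_rcons. Qed.

Lemma history_rcons v p s : history v (rcons p s) = vertices v p.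
Proof. by rewrite /history scanl_rcons belast_rcons. Qed.

Lemma verticesE v p : vertices v p = rcons (history v p) (endpoint v p).
Proof.
by case/lastP: p => [//|p s]; rewrite vertices_rcons history_rcons endpoint_rcons.
Qed.

Lemma endpoint_vertices v p : endpoint v p \in vertices v p.
Proof. by rewrite verticesE mem_rcons mem_head. Qed.

Lemma vertices_catl v p r w : w \in vertices v p -> w \in vertices v (p ++ r).
Proof. by rewrite /vertices scanl_cat !inE mem_cat orbA => ->. Qed.

Lemma vertices_le v p w : w \in vertices v p -> w.1 <= (endpoint v p).1.
Proof.
elim/last_ind: p => [|p s IHp]; first by rewrite inE => /eqP ->.
rewrite vertices_rcons mem_rcons in_cons endpoint_rcons => /orP[/eqP -> //|/IHp].
by case: s => /=; lia.
Qed.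

Lemma endpoint_nseq v k : endpoint v (nseq k South) = (v.1, v.2 - k%:Z).
Proof.
elim: k v => [|k IHk] v; first by case: v => x y /=; congr pair; lia.
by rewrite /endpoint /= -/(endpoint _ _) IHk /=; congr pair; lia.
Qed.

(** Prefixes of p followed by infinitely many South steps.  The extension makes
every finished path run into a vertex of height -1, so that each path always
has exactly one next step and finished paths need no flag of their own. *)
Definition south_prefix q p := q == mkseq (nth South p) (size q).

Lemma south_prefix_rcons q s p :
  south_prefix (rcons q s) p = south_prefix q p && (nth South p (size q) == s).
Proof.
rewrite /south_prefix size_rcons.
have -> : mkseq (nth South p) (size q).+1 =
   rcons (mkseq (nth South p) (size q)) (nth South p (size q)).
  by rewrite /mkseq -addn1 iotaD map_cat /= cats1.
by rewrite eqseq_rcons [s == _]eq_sym.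
Qed.

Lemma south_prefix_self p : south_prefix p p.
Proof. by rewrite /south_prefix /mkseq map_nth_iota0 // take_size. Qed.

Lemma south_prefixP q p : south_prefix q p ->
  (exists r, p = q ++ r) \/ (exists k, q = p ++ nseq k.+1 South).
Proof.
move/eqP=> eq_q; case: (leqP (size q) (size p)) => [le_qp|lt_pq].
  left; exists (drop (size q) p); rewrite -[LHS](cat_take_drop (size q)).
  by congr cat; rewrite [RHS]eq_q /mkseq map_nth_iota0.
right; exists (size q - size p).-1.
have szE : (size q - size p).-1.+1 = (size q - size p)%N by lia.
rewrite szE [LHS]eq_q; apply: (@eq_from_nth _ South).
  by rewrite size_mkseq size_cat size_nseq; lia.
rewrite size_mkseq => i lti; rewrite nth_mkseq // nth_cat; case: ltnP => // le_pi.
by rewrite nth_nseq if_same nth_default.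
Qed.

(** While its head is nonnegative, a prefix of p South South ... is a prefix of p;
a negative head has left p through its end point. *)
Lemma schroder_south_prefix r s p q : schroder r s p -> south_prefix q p ->
  (0 <= (endpoint (r, 0) q).2 -> endpoint (r, 0) q \in vertices (r, 0) p) /\
  ((endpoint (r, 0) q).2 < 0 -> (endpoint (r, 0) q).1 = s).
Proof.
case/andP=> /eqP endp /allP posp /south_prefixP[[t def_p]|[k def_q]].
  have q_in : endpoint (r, 0) q \in vertices (r, 0) p.
    by rewrite def_p; apply/vertices_catl/endpoint_vertices.
  by split=> //; have /= := posp _ q_in; lia.
rewrite def_q /endpoint foldl_cat endp -/(endpoint _ _) endpoint_nseq /=.
by split=> //; lia.
Qed.

End Paths.

(** * The path weights that fill the determinant *)

Section Green.
Variables (F : fieldType) (a b : nat -> F).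

(** The weight of all paths from v to (j, -1), the last step being an extra South
step of weight 1 from (j, 0).  A vertex below the axis is already an end. *)
Definition green (v : int * int) (j : nat) : F :=
  match v.2 with
  | Negz _ => (v.1 == j%:Z)%:R
  | Posz y => if v.1 <= j%:Z then schroder_table a b y `|j%:Z - v.1|%N else 0
  end.

(** South from height 0 is the extra final step; no genuine path uses it. *)
Definition step_wt (v : int * int) (s : step) : F :=
  match s with
  | NE => 1
  | East => b `|v.2|%N
  | South => if v.2 == 0 then 1 else a `|v.2|%N
  end.

Lemma sum_step (V : nmodType) (G : step -> V) :
  \sum_(s : step) G s = G NE + G East + G South.
Proof.
rewrite (bigD1 NE) //= (bigD1 East) /=; last exact/eqP.
rewrite (bigD1 South) /=; last by apply/andP; split; apply/eqP.
by rewrite big1 ?addr0 ?addrA // => -[]; rewrite !eqxx ?andbF.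
Qed.

Lemma green_step v j : 0 <= v.2 ->
  green v j = \sum_(s : step) step_wt v s * green (move v s) j.
Proof.
case: v => x [y|y] // _; rewrite sum_step.
have -> : move (x, Posz y) NE = (x + 1, Posz y.+1) by congr pair => /=; lia.
rewrite [step_wt _ NE]/= mul1r [step_wt _ East]/=.
have -> : green (move (x, Posz y) East) j = if x + 1 <= j%:Z then
  schroder_table a b y `|j%:Z - (x + 1)%R|%N else 0 by [].
have -> : green (x + 1, Posz y.+1) j = if x + 1 <= j%:Z then
  schroder_table a b y.+1 `|j%:Z - (x + 1)%R|%N else 0 by [].
have south0 : green (move (x, Posz 0) South) j = (x == j%:Z)%:R by [].
have southS k : green (move (x, Posz k.+1) South) j =
    if x <= j%:Z then schroder_table a b k `|j%:Z - x|%N else 0.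
  have -> : move (x, Posz k.+1) South = (x, Posz k) by congr pair => /=; lia.
  by [].
rewrite {1}/green [(x, Posz y).2]/= [(x, Posz y).1]/=.
have [lt_jx|le_xj] := ltrP j%:Z x.
  rewrite (_ : (x + 1 <= j%:Z) = false); last by lia.
  rewrite mulr0 !add0r; case: y => [|y].
    by rewrite south0 (_ : (x == _) = false) ?mulr0 //; lia.
  by rewrite southS ifF ?mulr0 //; lia.
have [lt_xj|ge_xj] := ltrP x j%:Z; last first.
  have eq_xj : x = j%:Z by lia.
  rewrite (_ : (x + 1 <= j%:Z) = false); last by lia.
  rewrite mulr0 !add0r; case: y => [|y].
    by rewrite south0 eq_xj subrr schroder_table00 eqxx mul1r.
  by rewrite southS eq_xj subrr lexx schroder_tableS0.
rewrite (_ : (x + 1 <= j%:Z) = true); last by lia.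
have -> : `|j%:Z - x|%N = `|j%:Z - (x + 1)%R|%N.+1 by lia.
case: y => [|y].
  rewrite south0 schroder_table0S (_ : (x == _) = false); last by lia.
  by rewrite mulr0 addr0 [RHS]addrC.
rewrite southS schroder_tableSS le_xj /=.
have -> : `|j%:Z - x|%N = `|j%:Z - (x + 1)%R|%N.+1 by lia.
by ring.
Qed.

Fixpoint path_wt (v : int * int) (q : seq step) : F :=
  if q is s :: q' then step_wt v s * path_wt (move v s) q' else 1.

Lemma path_wt_rcons v q s :
  path_wt v (rcons q s) = path_wt v q * step_wt (endpoint v q) s.
Proof.
elim: q v => [|t q IHq] v /=; first by rewrite mulr1 mul1r.
by rewrite IHq mulrA.
Qed.

Lemma wt_from_path_wt v p :
    all (fun w => 0 <= w.2) (vertices v p) -> (endpoint v p).2 = 0 ->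
  wt_from a b v p = path_wt v (rcons p South).
Proof.
elim: p v => [|s p IHp] v /=; first by move=> _ ->; rewrite eqxx !mulr1.
case/andP=> v_ge0 p_ge0 endp; rewrite IHp //; congr (_ * _).
case: s p_ge0 endp => //= /andP[Sv_ge0 _] _.
by have -> : (v.2 == 0) = false by lia.
Qed.

End Green.

(** * Non-intersecting tuples grown one step at a time *)

Section Heads.
Implicit Types u v h : int * int.

(** Every step goes up in this order: to the right, or downwards in the same
column. *)
Definition before h v := (h.1 < v.1) || (h.1 == v.1) && (v.2 < h.2).

(** The possible positions of the heads u and v of an inner and an outer path:
the inner path has not started yet and the outer one is still to its left; or
both run, the outer one above and at most one column ahead; or the inner one is
finished and the outer one is not behind it; or both are finished, in the right
order. *)
Definition nested u v :=
  [|| [&& v.1 < u.1, u.1 <= 0, u.2 == 0 & 0 <= v.2],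
      [&& u.1 <= v.1, u.2 < v.2 & (0 <= u.2) ==> (v.1 <= u.1 + 1)]
    | [&& u.2 == -1, v.2 == -1 & u.1 < v.1]].

Lemma before_move v s : before v (move v s).
Proof. by case: v => x y; rewrite /before; case: s => /=; lia. Qed.

Lemma before_trans v u h : before u v -> before v h -> before u h.
Proof. by rewrite /before; lia. Qed.

Lemma before_irr v : before v v = false.
Proof. by rewrite /before; lia. Qed.

(** Only the running path that comes first in [before] moves, which rules out all
configurations where the inner path could overtake the outer one. *)
Lemma nested_movel u v s : 0 <= u.2 -> -1 <= v.2 -> (0 <= v.2 -> before u v) ->
  move u s != v -> nested u v -> nested (move u s) v.
Proof.
case: u v => [x y] [x' y']; rewrite /nested /before -pair_eqE /=.
by case: s => /=; lia.
Qed.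

(** The outer path could end on the wrong side of the inner one only by going
below the axis to the left of the starting point of the inner path, that is
at a negative abscissa. *)
Lemma nested_mover u v s : 0 <= v.2 -> -1 <= u.2 -> (0 <= u.2 -> before v u) ->
  move v s != u -> ~~ (((move v s).2 < 0) && ((move v s).1 < 0)) ->
  nested u v -> nested u (move v s).
Proof.
case: u v => [x y] [x' y']; rewrite /nested /before -pair_eqE /=.
by case: s => /=; lia.
Qed.

End Heads.

Lemma increasing_ord_id n (f : 'I_n.+1 -> int) :
    (forall i j : 'I_n.+1, (i < j)%N -> f i < f j) ->
    (forall i, 0 <= f i) -> (forall i, f i <= n%:Z) ->
  forall i : 'I_n.+1, f i = i%:Z.
Proof.
move=> incr ge0 len.
have lower m (i : 'I_n.+1) : (m <= i)%N -> m%:Z <= f i.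
  elim: m i => [|m IHm] i ltmi; first exact: ge0.
  have ltm : (m < n.+1)%N by have := ltn_ord i; lia.
  by have := incr (Ordinal ltm) i ltmi; have := IHm (Ordinal ltm) (leqnn m); lia.
have upper m (i : 'I_n.+1) : (i + m <= n)%N -> f i + m%:Z <= n%:Z.
  elim: m i => [|m IHm] i ltmi; first by rewrite addr0.
  have lti : (i.+1 < n.+1)%N by lia.
  have := incr i (Ordinal lti) (leqnn _); have := IHm (Ordinal lti).
  by rewrite /=; lia.
move=> i; have := lower i i (leqnn _); have := upper (n - i)%N i.
by have := ltn_ord i; lia.
Qed.

Section NonIntersecting.
Variables (F : fieldType) (a b : nat -> F) (n : nat).
Implicit Types (Q : 'I_n.+1 -> seq step) (P : path_tuple n) (i j k : 'I_n.+1).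

Let start k : int * int := (- k%:Z, 0).
Let head Q k := endpoint (start k) (Q k).

Definition advance Q i s : 'I_n.+1 -> seq step :=
  fun k => if k == i then rcons (Q k) s else Q k.

(** From such a head no end point (j, -1) with 0 <= j <= n is reached. *)
Definition dead (v : int * int) := (n%:Z < v.1) || (v.2 < 0) && (v.1 < 0).

Lemma head_advance Q i s k :
  head (advance Q i s) k = if k == i then move (head Q i) s else head Q k.
Proof.
rewrite /head /advance; case: eqP => // ->.
by rewrite endpoint_rcons.
Qed.

Definition continues P Q := [forall k, south_prefix (Q k) (P k)].

(** The sum ranges over complete tuples and only filters them by the prefixes Q,
so that prolonging a prefix partitions the index set. *)
Definition path_sum Q : F := \sum_(P : path_tuple n | admissible P && continues P Q)
  \prod_(k < n.+1) wt_from a b (- k%:Z, 0) (P k).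

Definition green_matrix Q : 'M[F]_n.+1 := \matrix_(i, j) green a b (head Q i) j.

Definition green_det Q : F :=
  (\prod_(k < n.+1) path_wt a b (start k) (Q k)) * \det (green_matrix Q).

Lemma path_sum_advance Q i : path_sum Q = \sum_(s : step) path_sum (advance Q i s).
Proof.
rewrite /path_sum.
rewrite (partition_big (fun P => nth South (P i) (size (Q i))) predT) //=.
apply: eq_bigr => s _; apply: eq_bigl => P; rewrite -andbA; congr (_ && _).
apply/andP/forallP => [[/forallP QP nthP] k|QP].
  by rewrite /advance; case: eqP => // ->; rewrite south_prefix_rcons QP.
have /andP[] : south_prefix (Q i) (P i) && (nth South (P i) (size (Q i)) == s).
  by have := QP i; rewrite /advance eqxx south_prefix_rcons.
split=> //; apply/forallP => k; have := QP k; rewrite /advance.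
by case: eqP => // ->.
Qed.

(** Multilinearity in row i, which obeys the one-step recursion [green_step]. *)
Lemma green_det_advance Q i : 0 <= (head Q i).2 ->
  green_det Q = \sum_(s : step) green_det (advance Q i s).
Proof.
move=> ge0; rewrite /green_det.
rewrite (@det_row_lincomb _ step _ i _ (step_wt a b (head Q i))
           (fun s => green_matrix (advance Q i s))) => [|j|s k j nei].
- rewrite mulr_sumr; apply: eq_bigr => s _; rewrite mulrA; congr (_ * _).
  rewrite (bigD1 i) //= [RHS](bigD1 i) //= /advance eqxx path_wt_rcons.
  rewrite mulrAC; congr (_ * _); apply: eq_bigr => k /negPf -> //.
- rewrite mxE green_step //; apply: eq_bigr => s _.
  by rewrite mxE head_advance eqxx.
- by rewrite !mxE head_advance (negPf nei).
Qed.

Lemma green_dead v j : dead v -> (j <= n)%N -> green a b v j = 0.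
Proof.
case: v => x [y|y] /=; rewrite /dead /green /= => dv lejn.
  by rewrite ifF //; lia.
by rewrite (_ : (x == _) = false) //; lia.
Qed.

Lemma green_det_dead Q i : dead (head Q i) -> green_det Q = 0.
Proof.
move=> di; rewrite /green_det (@det_row0 _ _ i) ?mulr0 // => j.
by rewrite mxE green_dead // -ltnS.
Qed.

Lemma green_det_collision Q i k : i != k -> head Q i = head Q k -> green_det Q = 0.
Proof.
move=> neik eqh; rewrite /green_det (determinant_alternate neik) ?mulr0 // => j.
by rewrite !mxE eqh.
Qed.

Lemma admissible_head P Q i : admissible P -> continues P Q ->
  (0 <= (head Q i).2 -> head Q i \in path_vertices P i) /\
  ((head Q i).2 < 0 -> (head Q i).1 = i%:Z).
Proof.
case/andP=> /forallP schP _ /forallP QP.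
exact: schroder_south_prefix (schP i) (QP i).
Qed.

Lemma path_sum_dead Q i : dead (head Q i) -> path_sum Q = 0.
Proof.
move=> di; apply: big_pred0 => P; apply/negP => /andP[admP contP].
have [inP endP] := admissible_head i admP contP.
have lti := ltn_ord i.
case: (ltrP (head Q i).2 0) => [lt0|ge0].
  by have := endP lt0; move: di; rewrite /dead; lia.
have /vertices_le := inP ge0.
case/andP: admP => /forallP/(_ i)/andP[/eqP endPi _] _.
by rewrite /endpoint endPi /=; move: di; rewrite /dead; lia.
Qed.

(** At nonnegative height the common head is a common vertex of two paths; below
the axis it would be the end point of both. *)
Lemma path_sum_collision Q i k : i != k -> head Q i = head Q k -> path_sum Q = 0.
Proof.
move=> neik eqh; apply: big_pred0 => P; apply/negP => /andP[admP contP].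
have [inPi endPi] := admissible_head i admP contP.
have [inPk endPk] := admissible_head k admP contP.
case: (ltrP (head Q i).2 0) => [lt0|ge0].
  have lt0k : (head Q k).2 < 0 by rewrite -eqh.
  case/eqP: neik; apply: val_inj; apply/eqP; rewrite -eqz_nat /=.
  by rewrite -(endPi lt0) -(endPk lt0k) eqh.
have ge0k : 0 <= (head Q k).2 by rewrite -eqh.
case/andP: admP => _ /forallP/(_ i)/forallP/(_ k)/implyP/(_ neik)/hasPn.
by move/(_ _ (inPi ge0)); rewrite eqh inPk.
Qed.

(** What holds of prefixes grown by always moving the [before]-first running
head: in particular each vertex already passed precedes all running heads, so
a new vertex can only meet another path at its head. *)
Record front Q : Prop := Front {
  front_ge : forall i, -1 <= (head Q i).2;
  front_alive : forall i, ~~ dead (head Q i);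
  front_history : forall i h, h \in history (start i) (Q i) -> 0 <= h.2;
  front_before : forall i j h, h \in history (start i) (Q i) ->
    0 <= (head Q j).2 -> before h (head Q j);
  front_disjoint : forall i j w, i != j -> w \in vertices (start i) (Q i) ->
    w \notin vertices (start j) (Q j);
  front_nested : forall i j, (i < j)%N -> nested (head Q i) (head Q j)
}.

Lemma front_nil : front (fun=> [::]).
Proof.
split=> //= [i|i j w neij|i j ltij].
- by rewrite /dead /head /=; lia.
- rewrite !inE => /eqP ->; rewrite -pair_eqE /= andbT eqr_opp.
  by apply: contra neij => /eqP[/val_inj ->].
- by rewrite /nested /head /=; lia.
Qed.

Lemma head_neq Q i k : front Q -> i != k -> head Q i != head Q k.
Proof.
move=> fQ neik; apply: contraTneq (endpoint_vertices (start k) (Q k)).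
rewrite -/(head Q k) => <-.
by apply: (front_disjoint fQ neik); apply: endpoint_vertices.
Qed.

(** Distinct running heads are totally ordered by [before]: minimise the
abscissa, then maximise the height. *)
Lemma front_first Q i0 : front Q -> 0 <= (head Q i0).2 ->
  exists2 i, 0 <= (head Q i).2 &
    forall k, k != i -> 0 <= (head Q k).2 -> before (head Q i) (head Q k).
Proof.
move=> fQ ge0.
pose live k := 0 <= (head Q k).2.
case: (@arg_minP _ int _ i0 live (fun k => (head Q k).1) ge0) => i1 live1 min1.
pose left k := live k && ((head Q k).1 == (head Q i1).1).
have left1 : left i1 by rewrite /left live1 eqxx.
case: (@arg_maxP _ int _ i1 left (fun k => (head Q k).2) left1).
move=> i /andP[livei /eqP xi] max_i; exists i => // k neki livek.
have := min1 k livek; have := max_i k; have := head_neq fQ neki.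
rewrite /left /live /before livek -pair_eqE /pair_eq; move: xi; rewrite /=.
by case: (head Q k) (head Q i) => x y [x' y'] /=; lia.
Qed.

Lemma front_advance Q i s : front Q -> 0 <= (head Q i).2 ->
    (forall k, k != i -> 0 <= (head Q k).2 -> before (head Q i) (head Q k)) ->
    ~~ dead (move (head Q i) s) ->
    (forall k, k != i -> move (head Q i) s != head Q k) ->
  front (advance Q i s).
Proof.
move=> fQ gei firsti alive fresh.
have histE k h : h \in history (start k) (advance Q i s k) ->
    h \in history (start k) (Q k) \/ k = i /\ h = head Q i.
  rewrite /advance; case: eqP => [->|_]; last by left.
  by rewrite history_rcons verticesE mem_rcons in_cons => /orP[/eqP ->|]; [right|left].
have vertE k h : h \in vertices (start k) (advance Q i s k) ->
    h \in vertices (start k) (Q k) \/ k = i /\ h = move (head Q i) s.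
  rewrite /advance; case: eqP => [->|_]; last by left.
  by rewrite vertices_rcons mem_rcons in_cons => /orP[/eqP ->|]; [right|left].
(* The old vertices of path k precede head Q i, which precedes its successor. *)
have new k : k != i -> move (head Q i) s \notin vertices (start k) (Q k).
  move=> neki; rewrite verticesE mem_rcons in_cons negb_or fresh //=.
  apply/negP => /(front_before fQ)/(_ gei)/before_trans/(_ (before_move _ s)).
  by rewrite before_irr.
have bef k h : h \in history (start k) (advance Q i s k) -> before h (move (head Q i) s).
  case/histE => [/(front_before fQ)/(_ gei)|[_ ->]]; last exact: before_move.
  by move/before_trans; apply; apply: before_move.
split.
- move=> k; rewrite head_advance; case: eqP => _; last exact: front_ge.
  by case: s {alive fresh histE vertE new bef} => /=; lia.
- by move=> k; rewrite head_advance; case: eqP => _ //; apply: front_alive.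
- by move=> k h /histE[/(front_history fQ)|[_ ->]].
- move=> k j h hist; rewrite head_advance; case: eqP => [_ _|/eqP neji gej].
    exact: bef hist.
  by case/histE: hist => [/(front_before fQ)|[_ ->]]; [apply | apply: firsti].
- move=> k j w nekj /vertE[inQ|[eqki ->]]; apply/negP => /vertE[inQ'|[eqji]].
  + by have /negP := front_disjoint fQ nekj inQ.
  + by move=> eqw; have := new k; rewrite -eqw inQ -eqji nekj => /(_ isT).
  + by have := new j; rewrite inQ' -eqki eq_sym nekj => /(_ isT).
  + by case/eqP: nekj; rewrite eqki eqji.
- move=> k j ltkj; rewrite !head_advance.
  have nekj : k != j by rewrite neq_ltn ltkj.
  have := front_nested fQ ltkj.
  case: (k =P i) => [eqki|/eqP neki].
    have neji : j != i by rewrite -eqki eq_sym.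
    rewrite (negPf neji) eqki; apply: nested_movel => //.
    - exact: front_ge.
    - exact: firsti.
    - exact: fresh.
  case: (j =P i) => [eqji|_ //].
  rewrite eqji; apply: nested_mover => //.
  - exact: front_ge.
  - exact: firsti.
  - exact: fresh.
  - by apply: contra alive; rewrite /dead => ->; rewrite orbT.
Qed.

(** When all paths are finished, [nested] sorts the n + 1 distinct ends among
0, ..., n, so path i ends at (i, 0): the determinant is 1 and the prefixes, less
their final South step, form the only tuple in the sum. *)
Lemma path_sum_complete Q : front Q -> (forall i, (head Q i).2 < 0) ->
  path_sum Q = green_det Q.
Proof.
move=> fQ lt0.
have eqN1 i : (head Q i).2 = -1 by have := front_ge fQ i; have := lt0 i; lia.
have headE i : head Q i = (i%:Z, -1).
  rewrite (surjective_pairing (head Q i)) eqN1; congr pair.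
  apply: (increasing_ord_id (f := fun i => (head Q i).1)) => [k j|k|k].
  - by move/(front_nested fQ); rewrite /nested !eqN1; lia.
  - by have := front_alive fQ k; rewrite /dead eqN1; lia.
  - by have := front_alive fQ k; rewrite /dead eqN1; lia.
have: forall i, exists p : (4 * n).-bseq step,
    Q i = rcons p South /\ schroder (- i%:Z) i%:Z p.
  move=> i; case/lastP E: (Q i) => [|p s].
    by have := headE i; rewrite /head E => -[_].
  have p_ge0 : all (fun w => 0 <= w.2) (vertices (start i) p).
    by apply/allP => w w_in; apply: (front_history fQ (i := i)); rewrite E history_rcons.
  have endp : endpoint (start i) p = (i%:Z, 0) /\ s = South.
    have := allP p_ge0 _ (endpoint_vertices _ _); have := headE i.
    rewrite /head E endpoint_rcons; case: (endpoint _ p) => x y /=.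
    by case: s {E} => -[<- ?] y0; (try lia); split=> //; congr pair; lia.
  have schp : schroder (- i%:Z) i%:Z p.
    by rewrite /schroder -/(endpoint _ _) endp.1 eqxx.
  have szp : (size p <= 4 * n)%N.
    by have := schroder_size schp; have := ltn_ord i; lia.
  by exists (Bseq szp); rewrite endp.2.
case/fin_all_exists => p Qp.
have QE i : Q i = rcons (p i) South by case: (Qp i).
have schp i : schroder (- i%:Z) i%:Z (p i) by case: (Qp i).
pose P0 : path_tuple n := [ffun i => p i].
have uniqueP : (fun P => admissible P && continues P Q) =1 pred1 P0.
  move=> P; apply/andP/eqP => [[/andP[/forallP schP _] /forallP QP]|->]; last first.
    split; last first.
      rewrite /continues; apply/forallP => k; rewrite ffunE QE.
      rewrite south_prefix_rcons south_prefix_self.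
      by rewrite nth_default ?eqxx.
    apply/andP; split; first by apply/forallP => k; rewrite ffunE.
    apply/forallP => i; apply/forallP => j; apply/implyP => neij; apply/hasPn => w.
    rewrite /path_vertices !ffunE => w_in.
    have sub k : w \in vertices (start k) (p k) -> w \in vertices (start k) (Q k).
      by rewrite QE -cats1; apply: vertices_catl.
    by apply/negP => /sub; apply/negP; apply: (front_disjoint fQ neij); apply: sub.
  apply/ffunP => i; rewrite ffunE; apply: val_inj => /=.
  have := QP i; have := schP i; rewrite QE => /andP[/eqP endP /allP posP].
  case/south_prefixP => [[r def_P]|[k]].
    have : head Q i \in vertices (start i) (P i).
      by rewrite def_P -QE; apply/vertices_catl/endpoint_vertices.
    by move/posP; rewrite eqN1.
  have -> : nseq k.+1 South = rcons (nseq k South) South.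
    by elim: k => //= k ->.
  rewrite -rcons_cat => /rcons_inj[def_p].
  case: k def_p => [|k] def_p; first by rewrite def_p cats0.
  have /andP[_ /allP/(_ _ (endpoint_vertices _ _))] := schp i.
  by rewrite def_p /endpoint foldl_cat endP -/(endpoint _ _) endpoint_nseq.
rewrite /path_sum (big_pred1 P0) // /green_det.
have -> : green_matrix Q = 1%:M.
  apply/matrixP => i j; rewrite !mxE headE /green /=.
  by rewrite eqz_nat.
rewrite det1 mulr1; apply: eq_bigr => i _; rewrite ffunE QE.
have /andP[/eqP endp posp] := schp i.
by apply: wt_from_path_wt => //; rewrite /endpoint endp.
Qed.

(** Exceeds the number of steps still to come: each remaining column costs at most
two, a northeast step and the descent that undoes it. *)
Let steps_left (v : int * int) := absz (2 * (n%:Z + 1 - v.1) + (v.2 + 1)).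

Lemma steps_left_move v s : ~~ dead (move v s) -> 0 <= v.2 ->
  (steps_left (move v s) < steps_left v)%N.
Proof. by case: v => x y; rewrite /dead /steps_left; case: s => /=; lia. Qed.

(** The Lindstroem-Gessel-Viennot lemma for tuples with prescribed prefixes. *)
Lemma lgv_front Q : front Q -> path_sum Q = green_det Q.
Proof.
have [m] := ubnP (\sum_i steps_left (head Q i)); elim: m Q => // m IHm Q lt_m fQ.
case: (altP (@forallP _ (fun i => (head Q i).2 < 0))) => [lt0|].
  exact: path_sum_complete.
rewrite negb_forall => /existsP[i0]; rewrite -leNgt => /(front_first fQ)[i gei firsti].
rewrite (path_sum_advance _ i) (green_det_advance gei); apply: eq_bigr => s _.
have headi : head (advance Q i s) i = move (head Q i) s by rewrite head_advance eqxx.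
case: (boolP (dead (move (head Q i) s))) => [di|alive].
  by rewrite (@path_sum_dead _ i) ?(@green_det_dead _ i) ?headi.
case: (altP (@existsP _
  (fun k => (k != i) && (move (head Q i) s == head Q k)))).
  case=> k /andP[neki /eqP eqk].
  have eqh : head (advance Q i s) k = head (advance Q i s) i.
    by rewrite headi head_advance (negPf neki).
  by rewrite (path_sum_collision neki eqh) (green_det_collision neki eqh).
rewrite negb_exists => /forallP fresh; apply: IHm.
  apply: leq_trans (lt_m : (_ <= m)%N).
  rewrite [leqRHS](bigD1 i) //= (bigD1 i) //= headi -addSn.
  rewrite leq_add ?steps_left_move //.
  by apply: leq_sum => k /negPf neki; rewrite head_advance neki.
apply: front_advance => // k neki.
by have := fresh k; rewrite neki.
Qed.

End NonIntersecting.

Lemma f_hankel_moments (F : fieldType) n (a b : nat -> F) :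
  f_ n a b = \det (\matrix_(i < n.+1, j < n.+1) mu_RI b a (i + j)%N).
Proof.
have := lgv_front a b (front_nil n).
rewrite /path_sum /green_det [X in _ = X * _]big1 ?mul1r //.
under eq_bigl => P.
  rewrite (_ : continues P _ = true) ?andbT; last by apply/forallP.
  over.
rewrite /f_ => ->; congr (\det _); apply/matrixP => i j; rewrite !mxE.
rewrite /green /= ifT; last by lia.
by rewrite schroder_table_moment; congr mu_RI; lia.
Qed.

(** * Moments, products of Lambda and the theorem *)

Section Moments.
Variable F : fieldType.
Implicit Types a b Lambda : nat -> F.

Lemma mu_RI0 b a : mu_RI b a 0 = 1.
Proof. by rewrite -schroder_table_moment schroder_table00. Qed.

(** The outermost level of the fraction, G' = 1 + b_0 t G' + a_1 t G' G.  When (a, b)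
is the image of a pair under delta_inv, G is the moment series of that pair. *)
Lemma mu_RI_rec b a n : mu_RI b a n.+1 = b 0%N * mu_RI b a n +
  a 1%N * \sum_(i < n.+1) mu_RI b a i * mu_RI (b \o succn) (a \o succn) (n - i)%N.
Proof.
pose B k : fps F := fps_mono (b k) 1; pose A k : fps F := fps_mono (a k) 1.
have -> : mu_RI (b \o succn) (a \o succn) = tail B A 1.
  by apply: tail_shift => i; rewrite addn1.
change (mu_RI b a) with (tail B A 0).
rewrite {1}tailE // /fps_add fps_mulDl -fps_mulA /fps_add !fps_mul_mono /= subn1.
by rewrite [fps_mono _ _ _]/fps_mono add0r [fps_mul (tail _ _ 1) _]fps_mulC.
Qed.

Lemma f_stieltjes n a b L beta lambda : stieltjes_table beta lambda L ->
    (forall m, L m 0%N = mu_RI b a m) ->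
  f_ n a b = \prod_(k < n.+1) \prod_(1 <= i < k.+1) lambda i.
Proof.
move=> tabL muL; rewrite f_hankel_moments -(hankel_det tabL); congr (\det _).
by apply/matrixP => i j; rewrite !mxE muL.
Qed.

Lemma dyck_table Lambda : exists2 L, stieltjes_table (fun=> 0) Lambda L &
  forall n, L n 0%N = mu_OP Lambda n.
Proof.
have [L tabL momL] := stieltjes_table_exists (fun=> 0) Lambda.
exists L => // n; rewrite momL /mu_OP.
have -> // : fps_mono 0 1 = fps_mono 0 0 :> fps F.
by apply: functional_extensionality => i; rewrite /fps_mono !if_same.
Qed.

Section Products.
Variables (a b Lambda : nat -> F).
Hypothesis eq_mu : forall n, mu_OP Lambda (2 * n)%N = mu_RI b a n.

(** The first ratio formula without division: f_n / f_(n-1) is the last factor. *)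
Lemma f_prod n : f_ n a b =
  \prod_(k < n.+1) \prod_(1 <= i < (2 * k).+1) Lambda i.
Proof.
have [L tabL momL] := dyck_table Lambda.
rewrite (f_stieltjes n (even_contraction tabL)) => [|m]; last first.
  by rewrite -eq_mu -momL.
apply: eq_bigr => k _; elim: (val k) => [|m IHm]; first by rewrite !big_geq.
rewrite big_nat_recr // IHm (_ : (2 * m.+1 = (2 * m).+2)%N); last by lia.
by rewrite !(@big_nat_recr _ _ _ _.+1) //= mulrA.
Qed.

(** For k > 0 the inner product is a_0 Lambda_1 ... Lambda_(2k-1), with the factors
grouped as they appear in the continued fraction. *)
Lemma f_delta_prod n : f_ n (delta_inv a) (delta_inv b) =
  \prod_(k < n.+1) \prod_(0 <= i < k)
    (if i is _.+1 then Lambda (2 * i)%N * Lambda (2 * i).+1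
     else a 0%N * Lambda 1%N).
Proof.
have [L tabL momL] := dyck_table Lambda.
have [|n'|||L' tabL' momL'] := @stieltjes_cons _ _ _ _ (mu_RI b a)
    (mu_RI (delta_inv b) (delta_inv a)) 1 (a 0%N) (Lambda 1%N) (odd_contraction tabL).
- exact: mu_RI0.
- by rewrite -eq_mu -momL (moment_odd tabL).
- exact: mu_RI0.
- exact: mu_RI_rec.
rewrite (f_stieltjes n tabL' momL'); apply: eq_bigr => k _.
by rewrite big_add1 /=; apply: eq_bigr => -[].
Qed.

End Products.

(** With constant coefficients all tails coincide, so Y = 1 + 3 t Y + 2 t^2 Y^2. *)
Lemma ones_rec n (y := inf_cfrac (fun=> fps_mono (3 : F) 1) (fun=> fps_mono 2 2%N)) :
  y n.+1 = 3 * y n + 2 * \sum_(i < n) y i * y (n.-1 - i)%N.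
Proof.
pose B (k : nat) : fps F := fps_mono 3 1; pose A (k : nat) : fps F := fps_mono 2 2%N.
have yE : tail B A 1 = y by apply/esym/tail_shift.
change y with (tail B A 0).
rewrite {1}tailE // yE /fps_add fps_mulDl -fps_mulA /fps_add !fps_mul_mono /= subn1.
rewrite [fps_mono 1 _ _]/fps_mono add0r; congr (_ + _).
by case: n => [|n]; rewrite ?big_ord0 ?mulr0 ?subn2.
Qed.

(** The large Schroeder numbers g satisfy G = 1 + t G + t G^2, and G = 1 + 2 t Y with Y
as in [ones_rec]: both sides obey the same recursion. *)
Lemma f_ones n : f_ n (fun=> 1) (fun=> 1) = 2 ^+ 'C(n.+1, 2) :> F.
Proof.
pose g := mu_RI (fun=> 1 : F) (fun=> 1).
have g0 : g 0%N = 1 by exact: mu_RI0.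
have gS m : g m.+1 = 1 * g m + 1 * \sum_(i < m.+1) g i * g (m - i)%N.
  exact: mu_RI_rec.
have [L tabL momL] := stieltjes_table_exists (fun=> 3 : F) (fun=> 2).
have gL m : g m.+1 = 2 * L m 0%N.
  have [p] := ubnP m; elim: p m => // p IHp [|m] ltmp.
    have L00 : L 0%N 0%N = 1 by case: tabL => ->.
    by rewrite gS big_ord1 subn0 L00 g0; ring.
  rewrite gS big_ord_recl big_ord_recr /= subn0 subnn g0 momL ones_rec -momL.
  rewrite IHp //.
  have -> : \sum_(i < m) g (bump 0 i) * g (m.+1 - bump 0 i)%N =
     4 * \sum_(i < m) L i 0%N * L (m.-1 - i)%N 0%N.
    rewrite mulr_sumr; apply: eq_bigr => i _; have lti := ltn_ord i.
    rewrite /bump /= add1n subSS (_ : (m - i)%N = (m.-1 - i).+1); last by lia.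
    rewrite !IHp; try lia; ring.
  under [in RHS]eq_bigr do rewrite -!momL.
  ring.
have [L' tabL' momL'] := stieltjes_cons tabL g0 gL g0 gS.
rewrite (f_stieltjes n tabL' momL') -bin2_sum expr_sum big_mkord.
apply: eq_bigr => k _.
transitivity (\prod_(1 <= i < k.+1) (2 : F)).
  by apply: eq_bigr => -[|[|i]] _ //; rewrite mul1r.
by rewrite prodr_const_nat subn1.
Qed.

End Moments.

Theorem theorem7p2 (F : fieldType) :
  (forall a b Lambda : nat -> F,
     (forall n : nat, mu_OP Lambda (2 * n)%N = mu_RI b a n) ->
     forall n : nat, (1 <= n)%N ->
       (f_ n.-1 a b != 0 ->
          \prod_(1 <= k < (2 * n).+1) Lambda k = f_ n a b / f_ n.-1 a b)
       /\
       (a 0%N != 0 -> f_ n.-1 (delta_inv a) (delta_inv b) != 0 ->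
          \prod_(1 <= k < 2 * n) Lambda k =
          (a 0%N)^-1 *
          (f_ n (delta_inv a) (delta_inv b) /
           f_ n.-1 (delta_inv a) (delta_inv b))))
  /\
  (forall n : nat, f_ n (fun=> 1) (fun=> 1) = 2 ^+ 'C(n.+1, 2) :> F).
Proof.
split=> [a b Lambda eq_mu [|n] // _ /=|n]; last exact: f_ones.
split=> [f_neq0|a0_neq0 f_neq0].
  rewrite (f_prod eq_mu n.+1) big_ord_recr /= -(f_prod eq_mu n).
  by rewrite mulrAC divff ?mul1r.
rewrite (f_delta_prod eq_mu n.+1) big_ord_recr /= -(f_delta_prod eq_mu n).
rewrite [_ * _ / _]mulrAC divff // mul1r.
apply: (canRL (mulKf a0_neq0)).
elim: n {f_neq0} => [|n IHn]; first by rewrite !big_nat1.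
rewrite [RHS]big_nat_recr //= -IHn (_ : (2 * n.+2 = (2 * n.+1).+2)%N); last by lia.
by rewrite !(@big_nat_recr _ _ _ _.+1) //= ?mulrA //; lia.
Qed.
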